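(* Let $c<\tfrac12$ and $C>1$ be constants. For each $n$, let $n$ girls and $n$ boys have independent, uniformly random preference rankings, and let $G$ be one (fixed) of the girls. Then, with probability tending to $1$ as $n\to\infty$, the number of stable husbands of $G$ is at least $c\ln n$ and at most $C\ln n$.
   Context: There are $n$ girls and $n$ boys. Each girl has a preference ranking, which is a permutation of the set of $n$ boys, and each boy has a preference ranking, which is a permutation of the set of $n$ girls. In the random model the $2n$ permutations are independent and each is uniformly distributed over the $n!$ possibilities. A matching is a bijection between the girls and the boys. It is stable if there is no girl and boy who both prefer each other to their current partners in the matching. The stable husbands of a girl $G$ are the boys to whom she is matched in at least one stable matching (for the given preferences). $\ln$ is the natural logarithm. *)

(* Defs.v *)
From mathcomp Require Import all_boot all_fingroup all_algebra.

Set Implicit Arguments.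
Unset Strict Implicit.
Unset Printing Implicit Defensive.

Import GRing.Theory.
Local Open Scope ring_scope.

(* The n girls and the n boys are each labelled by 'I_n. A ranking r of one
   side is the permutation sending a person x to its position r x, position 0
   being the favourite. *)
Definition ranking (n : nat) := {perm 'I_n}.

Definition prefers (n : nat) (r : ranking n) (x y : 'I_n) : bool :=
  (r x < r y)%N.

(* First component: the girls' rankings of the boys; second component: the
   boys' rankings of the girls. *)
Definition profile (n : nat) : finType :=
  ({ffun 'I_n -> {perm 'I_n}} * {ffun 'I_n -> {perm 'I_n}})%type.

Definition girl_ranking (n : nat) (p : profile n) (g : 'I_n) : ranking n :=
  p.1 g.

Definition boy_ranking (n : nat) (p : profile n) (b : 'I_n) : ranking n :=
  p.2 b.

(* A matching m is a bijection from girls to boys: m g is the husband of g and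
   (m^-1)%g b is the wife of b. *)
Definition matching (n : nat) := {perm 'I_n}.

Definition blocking (n : nat) (p : profile n) (m : matching n)
    (g b : 'I_n) : bool :=
  prefers (girl_ranking p g) b (m g)
  && prefers (boy_ranking p b) g ((m^-1)%g b).

Definition stable (n : nat) (p : profile n) (m : matching n) : bool :=
  ~~ [exists g : 'I_n, exists b : 'I_n, blocking p m g b].

Definition stable_husbands (n : nat) (p : profile n) (g : 'I_n) : {set 'I_n} :=
  [set b : 'I_n | [exists m : {perm 'I_n}, stable p m && (m g == b)]].

Definition uniform_weight (R : fieldType) (n : nat) (r : ranking n) : R :=
  (n`!%:R)^-1.

(* The joint law of 2n independent uniform rankings is the product of their
   marginal laws. *)
Definition profile_weight (R : fieldType) (n : nat) (p : profile n) : R :=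
  (\prod_(g < n) uniform_weight R (girl_ranking p g))
  * (\prod_(b < n) uniform_weight R (boy_ranking p b)).

Definition Pr (R : fieldType) (n : nat) (E : {set profile n}) : R :=
  \sum_(p in E) profile_weight R p.

(* Main.v *)
Require Import Defs.
From mathcomp Require Import all_boot all_order all_fingroup all_algebra.
From mathcomp Require Import zify ring lra.

(** Let the boys propose, always letting the first unengaged boy move; when all
    are engaged, G divorces her husband and the process goes on until a boy has
    exhausted his list. G only accepts a boy whom she prefers to all boys who
    proposed to her before, and the husbands she has in the stable states are
    exactly her stable husbands. Hence they correspond to records (left-to-right
    minima) in the sequence of ranks, for G, of the boys in order of arrival;
    conversely every record that arrives after the first stable state and before
    the last one is a stable husband.

    The next boy to arrive is determined by the ranks revealed so far, so this
    sequence of ranks is a uniformly random permutation: the record at position i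
    (counted from 0) has probability 1/(i+1), distinct positions are pairwise
    independent, and Chebyshev's inequality gives the upper bound C ln n.

    For the lower bound, a coupon-collector estimate bounds the total number of
    proposals before the first stable state by n w, up to a small probability.
    Averaging over the girls, G receives at most w^2 proposals before the first
    stable state; exchanging the sexes, she has a stable husband among her
    w^2 + 1 favourites. None of the first w^7 arrivals ranks that high if w^10 is
    about n, so all records at positions between w^2 and w^7 are stable husbands,
    and there are about 5 ln w, that is (1/2) ln n, of them. *)

Set Implicit Arguments.
Unset Strict Implicit.
Unset Printing Implicit Defensive.
Import Order.TTheory GRing.Theory Num.Theory.

(** * The proposal process *)

Section Process.
Variables (n : nat) (G : 'I_n).
Implicit Types (p : profile n) (k : {ffun 'I_n -> nat}) (b g : 'I_n).

(* In a state k, every boy b has proposed to his k b favourite girls. *)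
Definition proposed p k b g := p.2 b g < k b.

(* A divorced husband of G still counts among her proposers, so she can only
   become engaged again to a boy she prefers to all her former husbands. *)
Definition engaged p k b g :=
  ((p.2 b g).+1 == k b)
  && [forall b', proposed p k b' g ==> (p.1 g b <= p.1 g b')].

Definition single p k b := ~~ [exists g, engaged p k b g].

Definition complete p k := [forall b, ~~ single p k b].

(** The divorce happens here: in a complete state it is the husband of [G] who moves on. *)
Definition mover p k : 'I_n :=
  if [pick b | single p k b] is Some b then b
  else odflt G [pick b | engaged p k b G].

Definition step p k : {ffun 'I_n -> nat} :=
  [ffun b => if (b == mover p k) && (k b < n) then (k b).+1 else k b].

Definition traj p t := iter t (step p) [ffun=> 0].

Lemma step_ge p k b : k b <= step p k b.
Proof. by rewrite ffunE; case: ifP. Qed.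

Lemma traj_le p s t b : s <= t -> traj p s b <= traj p t b.
Proof.
move/subnK <-; elim: (t - s) => //= d IH.
exact: leq_trans IH (step_ge _ _ _).
Qed.

Lemma traj_le_n p t b : traj p t b <= n.
Proof.
elim: t => [|t IH]; first by rewrite ffunE.
by rewrite /= ffunE; case: ifP => // /andP[].
Qed.

Lemma sum_step_le p k : \sum_b step p k b <= (\sum_b k b).+1.
Proof.
rewrite (bigD1 (mover p k)) //= [X in _ <= X.+1](bigD1 (mover p k)) //=.
rewrite -addSn; apply: leq_add; first by rewrite ffunE; case: ifP.
by apply: leq_sum => b /negbTE nb; rewrite ffunE nb.
Qed.

Lemma sum_step p k :
  k (mover p k) < n -> \sum_b step p k b = (\sum_b k b).+1.
Proof.
move=> lt; rewrite (bigD1 (mover p k)) //= [X in _ = X.+1](bigD1 (mover p k)) //=.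
rewrite -addSn ffunE eqxx lt; congr (_ + _).
by apply: eq_bigr => b /negbTE nb; rewrite ffunE nb.
Qed.

Lemma sum_traj_le p t : \sum_b traj p t b <= t.
Proof.
elim: t => [|t IH]; first by rewrite big1 // => b _; rewrite ffunE.
exact: leq_trans (sum_step_le _ _) _.
Qed.

Lemma engaged_proposed p k b g : engaged p k b g -> proposed p k b g.
Proof. by case/andP=> /eqP; rewrite /proposed => <-. Qed.

Lemma engagedP p k b g :
  reflect ((p.2 b g).+1 = k b /\
           forall b', proposed p k b' g -> p.1 g b <= p.1 g b')
          (engaged p k b g).
Proof.
by apply: (iffP andP) => -[/eqP ? /forall_inP].
Qed.

Lemma engaged_injl p k b b' g :
  engaged p k b g -> engaged p k b' g -> b = b'.
Proof.
move=> e e'; case/engagedP: (e) => _ /(_ _ (engaged_proposed e')) h1.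
case/engagedP: (e') => _ /(_ _ (engaged_proposed e)) h2.
by apply: (@perm_inj _ (p.1 g)); apply/val_inj/eqP; rewrite eqn_leq h1 h2.
Qed.

Lemma engaged_injr p k b g g' :
  engaged p k b g -> engaged p k b g' -> g = g'.
Proof.
move=> /engagedP[e _] /engagedP[e' _].
by apply: (@perm_inj _ (p.2 b)); apply/val_inj/succn_inj; rewrite e e'.
Qed.

Lemma completeP p k :
  reflect (forall b, exists g, engaged p k b g) (complete p k).
Proof.
apply: (iffP forallP) => h b.
  by apply/existsP; move: (h b); rewrite negbK.
by rewrite negbK; apply/existsP.
Qed.

(** * Complete states and stable matchings *)

Lemma complete_matching p k :
  complete p k -> exists m : {perm 'I_n}, forall g, engaged p k (m g) g.
Proof.
move/completeP=> h; pose w b := xchoose (h b).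
have ew b : engaged p k b (w b) by apply: xchooseP.
have wI : injective w.
  by move=> b b' e; apply: (engaged_injl (ew b)); rewrite e; apply: ew.
exists (perm wI)^-1%g => g.
by have := ew ((perm wI)^-1%g g); rewrite -(permE wI) permKV.
Qed.

Lemma all_girls_complete p k :
  (forall g, exists b, engaged p k b g) -> complete p k.
Proof.
move=> h; pose w g := xchoose (h g).
have ew g : engaged p k (w g) g by exact: (xchooseP (h g)).
have wI : injective w.
  by move=> b b' e; apply: (engaged_injr (ew b)); rewrite e; apply: ew.
apply/completeP => b; exists ((perm wI)^-1%g b).
by have := ew ((perm wI)^-1%g b); rewrite -(permE wI) permKV.
Qed.

(** A boy who blocks with [g] ranks her above his wife, so he has already proposed to her; but [g]
    is engaged to the best of her proposers. *)
Lemma engaged_stable p k (m : {perm 'I_n}) :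
  (forall g, engaged p k (m g) g) -> stable p m.
Proof.
move=> em; apply/negP => /existsP[g /existsP[b /andP[]]].
rewrite /prefers /girl_ranking /boy_ranking => lg lb.
have := em (m^-1%g b); rewrite permKV => /engagedP[eb _].
have /engagedP[_ /(_ b)] := em g.
by rewrite /proposed -eb ltnS ltnW // leqNgt lg => /(_ isT).
Qed.


Lemma complete_noneP p k : complete p k = ~~ [exists b, single p k b].
Proof. by rewrite negb_exists. Qed.

Lemma mover_single p k : ~~ complete p k -> single p k (mover p k).
Proof.
rewrite complete_noneP negbK /mover => /existsP[b fb].
by case: pickP => [//|/(_ b)]; rewrite fb.
Qed.

Lemma mover_complete p k : complete p k -> engaged p k (mover p k) G.
Proof.
move=> cp; rewrite /mover; case: pickP => [b fb|_].
  by move/forallP/(_ b): cp; rewrite fb.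
case: pickP => //= none.
by have [m /(_ G)] := complete_matching cp; rewrite none.
Qed.

Lemma singleNengaged p k b g : single p k b -> engaged p k b g = false.
Proof. by move=> fb; apply: contraNF fb => e; apply/existsP; exists g. Qed.

(** The mover is single or is the husband whom [G] divorces, so no other girl loses a fiancé by his
    moving. *)
Lemma mover_not_engaged p k g :
  (g != G) || ~~ complete p k -> engaged p k (mover p k) g = false.
Proof.
case: (boolP (complete p k)) => [cp|nc _]; last first.
  exact/singleNengaged/mover_single.
rewrite orbF => nG; apply: contra_neqF nG => e.
exact: engaged_injr e (mover_complete cp).
Qed.

(** * Courted girls and the first complete state *)

Definition courted p k g := [exists b, proposed p k b g].
Definition taken p k g := [exists b, engaged p k b g].

(** The hypothesis excludes a divorce of [g]. She then keeps her fiancé or exchanges him for a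
    better one, and she accepts a first proposal. *)
Lemma step_taken p k g :
  (g != G) || ~~ complete p k -> (courted p k g -> taken p k g) ->
  courted p (step p k) g -> taken p (step p k) g.
Proof.
move=> /mover_not_engaged ne IH.
set u := mover p k in ne.
have stE b : b != u -> step p k b = k b.
  by move=> /negbTE nu; rewrite ffunE nu.
have prE b : b != u -> proposed p (step p k) b g = proposed p k b g.
  by move=> nu; rewrite /proposed stE.
case: (boolP (proposed p (step p k) u g && ~~ proposed p k u g)).
  move=> /andP[pu npu] _.
  have eu : (p.2 u g).+1 = step p k u.
    move: pu npu; rewrite /proposed ffunE eqxx /=; case: ifP => _; lia.
  case: (boolP (taken p k g)) => [/existsP[b eb]|nt].
    case: (leqP (p.1 g u) (p.1 g b)) => [le|lt].
      apply/existsP; exists u; apply/engagedP; split=> // b'.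
      have [-> //|nb'] := eqVneq b' u; rewrite prE // => pb'.
      by case/engagedP: eb => _ /(_ _ pb'); apply: leq_trans.
    have nbu : b != u by apply: contraTneq eb => ->; rewrite ne.
    apply/existsP; exists b; case/engagedP: eb => e1 e2.
    apply/engagedP; rewrite stE //; split=> // b'.
    have [->|nb'] := eqVneq b' u; first by move=> _; apply: ltnW.
    by rewrite prE //; apply: e2.
  apply/existsP; exists u; apply/engagedP; split=> // b'.
  have [-> //|nb'] := eqVneq b' u; rewrite prE // => pb'.
  by case/negP: nt; apply: IH; apply/existsP; exists b'.
rewrite negb_and negbK => huu.
have prE' b : proposed p (step p k) b g = proposed p k b g.
  have [->|/prE //] := eqVneq b u.
  apply/idP/idP => [h|h]; first by move: huu; rewrite h.
  exact: leq_trans h (step_ge _ _ _).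
rewrite /courted (eq_existsb prE') => /IH /existsP[b eb].
have nbu : b != u by apply: contraTneq eb => ->; rewrite ne.
apply/existsP; exists b; case/engagedP: eb => e1 e2.
by apply/engagedP; rewrite stE //; split=> // b'; rewrite prE' => /e2.
Qed.

Lemma courted_traj p s t g :
  s <= t -> courted p (traj p s) g -> courted p (traj p t) g.
Proof.
move=> st /existsP[b h]; apply/existsP; exists b.
exact: leq_trans h (traj_le _ _ st).
Qed.

Lemma taken_courted p k g : taken p k g -> courted p k g.
Proof. by case/existsP=> b /engaged_proposed h; apply/existsP; exists b. Qed.

Lemma complete_taken p k g : complete p k -> taken p k g.
Proof. by case/complete_matching=> m /(_ g) e; apply/existsP; exists (m g). Qed.

Lemma courted0 p g : courted p (traj p 0) g = false.
Proof. by apply/existsP => -[b]; rewrite /proposed ffunE. Qed.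

Lemma courted_taken p t g : g != G -> courted p (traj p t) g -> taken p (traj p t) g.
Proof.
move=> nG; elim: t => [|t IH]; first by rewrite courted0.
by apply: step_taken => //; rewrite nG.
Qed.

(** Before the first complete state there is no divorce, so even [G] is taken once courted. *)
Lemma courted_complete p t : (forall g, courted p (traj p t) g) ->
  exists2 s, s <= t & complete p (traj p s).
Proof.
move=> ct.
case: (boolP [exists s : 'I_t.+1, complete p (traj p s)]) => [/existsP[s cs]|].
  by exists s; [rewrite -ltnS|].
rewrite negb_exists => /forallP nc; exists t => //.
apply: all_girls_complete => g; apply/existsP.
suff h s : s <= t -> courted p (traj p s) g -> taken p (traj p s) g by apply: h.
elim: s => [|s IH] st; first by rewrite courted0.
apply: step_taken; last by apply: IH; apply: ltnW.
by have /= -> := nc (Ordinal (ltnW st : s < t.+1)); rewrite orbT.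
Qed.

(** The number of proposals made when every boy stops at his wife in [m]. *)
Definition husband_rank_sum p (m : {perm 'I_n}) :=
  \sum_b (p.2 b ((m^-1)%g b)).+1.

Lemma courted_stable p t : (forall g, courted p (traj p t) g) ->
  exists2 m, stable p m & husband_rank_sum p m <= t.
Proof.
move=> /courted_complete[s st /complete_matching[m em]]; exists m.
  exact: engaged_stable em.
apply: leq_trans (leq_trans (sum_traj_le p s) st).
apply: leq_sum => b _; have := em ((m^-1)%g b).
by rewrite permKV => /engagedP[-> _].
Qed.

(** * Every stable husband of [G] is reached *)

Definition below_stable p (m : {perm 'I_n}) k :=
  forall b, k b <= (p.2 b ((m^-1)%g b)).+1.

(** A boy about to go past his wife in [m] has lost her to a proposer she prefers. That rival has
    not gone past his own wife, so he ranks the girl above her and the two block [m]. *)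
Lemma mover_below_stable p m k : stable p m -> below_stable p m k ->
  ~~ (complete p k && engaged p k (m G) G) ->
  k (mover p k) < (p.2 (mover p k) ((m^-1)%g (mover p k))).+1.
Proof.
set u := mover p k => sm le nc.
rewrite ltn_neqAle le andbT; apply/eqP => eu.
pose g := (m^-1)%g u.
case: (boolP (engaged p k u g)) => [e|ne].
  case: (boolP (complete p k)) => cp.
    have eG := engaged_injr e (mover_complete cp).
    by case/negP: nc; rewrite cp -eG /g permKV.
  by move: e; rewrite mover_not_engaged // cp orbT.
move: ne; rewrite /engaged -/g eu eqxx /= => /forall_inPn[b' pb'].
rewrite -ltnNge => lt.
have nb : b' != u by apply: contraTneq lt => ->; rewrite ltnn.
case/negP: sm; apply/existsP; exists g; apply/existsP; exists b'.
rewrite /blocking /prefers /girl_ranking /boy_ranking /g permKV lt /=.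
rewrite ltn_neqAle -ltnS (leq_trans pb' (le b')) andbT.
apply/eqP => /val_inj/perm_inj e.
by case/eqP: nb; apply: (@perm_inj _ (m^-1)%g); rewrite -e.
Qed.

Lemma stable_reached p m : stable p m ->
  exists2 t, t <= n * n & [/\ complete p (traj p t), engaged p (traj p t) (m G) G
              & below_stable p m (traj p t)].
Proof.
move=> sm.
pose P t := complete p (traj p t) && engaged p (traj p t) (m G) G.
suff [t tn [le Pt]] : exists2 t, t <= n * n & below_stable p m (traj p t) /\ P t.
  by exists t => //; case/andP: Pt.
case: (boolP [exists t : 'I_(n * n).+1,
  [forall b, traj p t b <= (p.2 b ((m^-1)%g b)).+1] && P t]).
  by case/existsP=> t /andP[/forallP le Pt]; exists t; [rewrite -ltnS|].
rewrite negb_exists => /forallP no.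
(* If the state sought never occurred, each step would add a proposal, and by time [n * n + 1] there
   would be more proposals than entries in the lists. *)
have H t : t <= (n * n).+1 -> below_stable p m (traj p t) /\ \sum_b traj p t b = t.
  elim: t => [_|t IH lt].
    split; last by rewrite big1 // => b _; rewrite ffunE.
    by move=> b; rewrite ffunE.
  have [le st] := IH (ltnW lt).
  have := no (Ordinal lt); rewrite negb_and; case/orP => /=.
    by case/forallP.
  move=> nP; have ltu := mover_below_stable sm le nP.
  split.
    move=> b; rewrite /= ffunE; case: ifP => // /andP[/eqP -> _] //.
  by rewrite /= sum_step ?st //; apply: leq_trans ltu _.
have [_ e] := H _ (leqnn _).
have : \sum_b traj p (n * n).+1 b <= \sum_(b < n) n.
  by apply: leq_sum => b _; apply: traj_le_n.
by rewrite e sum_nat_const card_ord ltnn.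
Qed.

End Process.

Definition record n (s : {perm 'I_n}) (i : 'I_n) :=
  [forall j : 'I_n, (j < i) ==> (s i < s j)].

(** * Arrivals at G *)

Section Arrival.
Variables (n : nat) (G : 'I_n).
Implicit Types (p : profile n) (k : {ffun 'I_n -> nat}) (b g : 'I_n).

Local Notation traj := (traj G).
Local Notation horizon := (n * n).

Fixpoint arrivals p t : seq 'I_n :=
  if t is t'.+1 then
    arrivals p t' ++ [seq b <- enum 'I_n | proposed p (traj p t) b G
                                          & b \notin arrivals p t']
  else [::].

Lemma mem_arrivals p t b : (b \in arrivals p t) = proposed p (traj p t) b G.
Proof.
elim: t => [|t IH]; first by rewrite /proposed ffunE.
rewrite [LHS]mem_cat mem_filter mem_enum inE andbT IH.
case: (boolP (proposed p (traj p t) b G)) => [h|_] /=; last by rewrite andbT.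
by symmetry; apply: leq_trans h (step_ge _ _ _ _).
Qed.

Lemma arrivals_uniq p t : uniq (arrivals p t).
Proof.
elim: t => //= t IH; rewrite cat_uniq IH filter_uniq ?enum_uniq // andbT.
by apply/hasPn => b; rewrite mem_filter => /andP[/andP[]].
Qed.

Lemma arrivals_prefix p s t : s <= t -> prefix (arrivals p s) (arrivals p t).
Proof.
move/subnK <-; elim: (t - s) => [|d IH]; first exact: prefix_refl.
exact: prefix_trans IH (prefix_prefix _ _).
Qed.

(** Boys who do not propose to [G] within the horizon are appended by label, so that the order of
    arrival is a permutation of all boys. *)
Definition arrival_seq p :=
  arrivals p horizon ++ [seq b <- enum 'I_n | b \notin arrivals p horizon].

Lemma arrival_seq_uniq p : uniq (arrival_seq p).
Proof.
rewrite cat_uniq arrivals_uniq filter_uniq ?enum_uniq // andbT.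
by apply/hasPn => b; rewrite mem_filter => /andP[].
Qed.

Lemma mem_arrival_seq p b : b \in arrival_seq p.
Proof. by rewrite mem_cat mem_filter mem_enum andbT orbN. Qed.

Lemma index_arrival_lt p b : index b (arrival_seq p) < n.
Proof.
rewrite -[X in _ < X](size_enum_ord n).
have/perm_size <- : perm_eq (arrival_seq p) (enum 'I_n).
  apply: uniq_perm; rewrite ?arrival_seq_uniq ?enum_uniq // => x.
  by rewrite mem_enum mem_arrival_seq.
by rewrite index_mem mem_arrival_seq.
Qed.

Lemma index_arrival_inj p : injective (fun b => Ordinal (index_arrival_lt p b)).
Proof.
move=> b b' /(congr1 val) /= e.
by rewrite -(nth_index b (mem_arrival_seq p b)) e nth_index ?mem_arrival_seq.
Qed.

Definition arrival p : {perm 'I_n} := perm (@index_arrival_inj p).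

Lemma arrivalE p b : arrival p b = index b (arrival_seq p) :> nat.
Proof. by rewrite permE. Qed.

Lemma index_arrival p t b : t <= horizon -> b \in arrivals p t ->
  arrival p b = index b (arrivals p t) :> nat.
Proof.
move=> tT bt; rewrite arrivalE /arrival_seq.
by have /prefixP[u ->] := arrivals_prefix p tT; rewrite -catA index_cat bt.
Qed.

Lemma arrival_lt p t b : t <= horizon ->
  (arrival p b < size (arrivals p t)) = proposed p (traj p t) b G.
Proof.
move=> tT; rewrite -mem_arrivals; case: (boolP (b \in arrivals p t)) => bt.
  by rewrite (index_arrival tT bt) index_mem.
rewrite arrivalE /arrival_seq; have /prefixP[u ->] := arrivals_prefix p tT.
by rewrite -catA index_cat (negbTE bt) ltnNge leq_addr.
Qed.

Lemma size_arrivals p t :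
  size (arrivals p t) = #|[set b | proposed p (traj p t) b G]|.
Proof.
rewrite cardE; apply/perm_size/uniq_perm; rewrite ?arrivals_uniq ?enum_uniq //.
by move=> b; rewrite mem_arrivals mem_enum inE.
Qed.

(** The left factor acts first: a position in the order of arrival goes to the rank that [G] gives
    to the boy there. *)
Definition arrival_rank p : {perm 'I_n} := ((arrival p)^-1 * p.1 G)%g.

Lemma arrival_rankE p b : arrival_rank p (arrival p b) = p.1 G b.
Proof. by rewrite permM permK. Qed.

(** When [G] is engaged to [b], he is the best of her proposers so far, and these include all who
    arrived before him. *)
Lemma stable_husband_record p b :
  b \in stable_husbands p G -> record (arrival_rank p) (arrival p b).
Proof.
rewrite inE => /existsP[m /andP[sm /eqP eb]].
have [t tT [_ e _]] := stable_reached G sm; rewrite {}eb in e.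
apply/forall_inP => j; rewrite -(permKV (arrival p) j).
set b' := ((arrival p)^-1)%g j => lt; rewrite !arrival_rankE.
have pb : arrival p b < size (arrivals p t).
  by rewrite arrival_lt //; apply: engaged_proposed e.
case/engagedP: e => _ /(_ b'); rewrite -arrival_lt // => /(_ (ltn_trans lt pb)) le.
rewrite ltn_neqAle le andbT; apply: contraTneq lt => /val_inj/perm_inj ->.
by rewrite ltnn.
Qed.

Lemma card_stable_husbands_le p :
  #|stable_husbands p G| <= #|[set i | record (arrival_rank p) i]|.
Proof.
rewrite -(card_imset (stable_husbands p G) (@perm_inj _ (arrival p))).
apply/subset_leq_card/subsetP => _ /imsetP[b hb ->].
by rewrite inE stable_husband_record.
Qed.

Lemma new_proposal p t b g :
  proposed p (traj p t.+1) b g -> ~~ proposed p (traj p t) b g ->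
  b = mover G p (traj p t) /\ (p.2 b g).+1 = traj p t.+1 b.
Proof.
rewrite /proposed /= ffunE; case: ifP => [/andP[/eqP -> _]|_ -> //].
by move=> h1 h2; split=> //; lia.
Qed.

(** [G] accepts a boy who is a record. The other girls have been taken since the complete state at
    [s], so the state is complete again and yields a stable matching. *)
Lemma record_stable_husband p s t b :
  s <= t < horizon -> complete p (traj p s) ->
  proposed p (traj p t.+1) b G -> ~~ proposed p (traj p t) b G ->
  record (arrival_rank p) (arrival p b) -> b \in stable_husbands p G.
Proof.
move=> /andP[st tT] cs pb npb /forall_inP rb.
have [eb lb] := new_proposal pb npb.
have e : engaged p (traj p t.+1) b G.
  apply/engagedP; split=> // b' pb'.
  have [-> //|nb] := eqVneq b' b.
  have {pb'}pb' : proposed p (traj p t) b' G.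
    apply: contraNT nb => /(new_proposal pb')[-> _].
    by rewrite -eb.
  rewrite -!arrival_rankE; apply/ltnW/rb.
  move: npb pb'; rewrite -!(arrival_lt _ _ (ltnW tT)) -leqNgt => h1 h2.
  exact: leq_trans h2 h1.
have ce : complete p (traj p t.+1).
  apply: all_girls_complete => g; apply/existsP.
  have [->|nG] := eqVneq g G; first by apply/existsP; exists b.
  apply: courted_taken => //; apply: (@courted_traj _ _ _ s); first exact: leqW.
  by apply/taken_courted/complete_taken.
have [m em] := complete_matching ce.
rewrite inE; apply/existsP; exists m; rewrite (engaged_stable em) /=.
by apply/eqP; apply: engaged_injl (em G) e.
Qed.

(* If m is the first stable matching reached, these are the boys who proposed to
   g before it. *)
Definition suitors p (m : {perm 'I_n}) g :=
  #|[set b | p.2 b g <= p.2 b ((m^-1)%g b)]|.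

(** A complete state is reached before any boy has passed his wife in [m], hence after at most [a]
    arrivals at [G]. When [G] is engaged to [m' G], whose rank is at most [r], at least [K] boys
    have arrived. Records in between are stable husbands. *)
Lemma card_stable_husbands_ge p (a r K : nat) (m m' : {perm 'I_n}) :
  stable p m -> suitors p m G <= a ->
  stable p m' -> p.1 G (m' G) <= r ->
  (forall i : 'I_n, i < K -> r < arrival_rank p i) ->
  #|[set i : 'I_n | [&& a <= i, i < K & record (arrival_rank p) i]]|
    <= #|stable_husbands p G|.
Proof.
move=> sm ma sm' m'r hK.
have [s sT [cs _ ms]] := stable_reached G sm.
have [t tT [ct em' _]] := stable_reached G sm'.
have sa : size (arrivals p s) <= a.
  rewrite size_arrivals; apply: leq_trans ma.
  apply/subset_leq_card/subsetP => b; rewrite !inE => h.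
  by rewrite -ltnS; apply: leq_trans h (ms b).
have Kt : K <= size (arrivals p t).
  have := engaged_proposed em'; rewrite -arrival_lt // => /ltnW; apply: leq_trans.
  by rewrite leqNgt; apply/negP => /hK; rewrite arrival_rankE ltnNge m'r.
rewrite -(card_imset (stable_husbands p G) (@perm_inj _ (arrival p))).
apply/subset_leq_card/subsetP => i; rewrite inE => /and3P[ai iK ri].
rewrite -(permKV (arrival p) i) in ai iK ri *.
set b := ((arrival p)^-1)%g i in ai iK ri *.
apply: imset_f.
have nps : ~~ proposed p (traj p s) b G.
  by rewrite -arrival_lt // -leqNgt; apply: leq_trans sa ai.
have pt : proposed p (traj p t) b G.
  by rewrite -arrival_lt //; apply: leq_trans iK Kt.
have ext : exists u, proposed p (traj p u) b G by exists t.
(* [u.+1] is the time of the proposal of [b] to [G]; it lies after [s] and not after [t]. *)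
case: (ex_minnP ext) => -[|u] pu minu.
  by move: pu; rewrite /proposed ffunE.
apply: (@record_stable_husband _ s u) => //; last first.
  by apply/negP => /minu; rewrite ltnn.
rewrite (leq_trans (minu _ pt) tT) andbT leqNgt; apply/negP => us.
by case/negP: nps; apply: leq_trans pu (traj_le _ _ _ us).
Qed.

(* p and p' cannot be told apart by what the process has queried on its way to
   the state k. *)
Definition agree p p' k :=
  (forall b g j, j < k b -> (p.2 b g == j :> nat) = (p'.2 b g == j :> nat)) /\
  (forall g b b', proposed p k b g -> proposed p k b' g ->
     (p.1 g b <= p.1 g b') = (p'.1 g b <= p'.1 g b')).

Lemma agree_proposed p p' k b g : agree p p' k ->
  proposed p k b g = proposed p' k b g.
Proof.
case=> h _; rewrite /proposed; apply/idP/idP => lt.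
  by have := h _ g _ lt; rewrite eqxx => /esym/eqP ->.
by have := h _ g _ lt; rewrite eqxx => /eqP ->.
Qed.

Lemma agree_engaged p p' k b g : agree p p' k ->
  engaged p k b g = engaged p' k b g.
Proof.
move=> A; have [h1 h2] := A; rewrite /engaged.
have -> : ((p.2 b g).+1 == k b) = ((p'.2 b g).+1 == k b).
  by case e: (k b) => [//|j]; rewrite !eqSS; apply: h1; rewrite e.
have [e|//] := eqVneq (p'.2 b g).+1 (k b).
have pb : proposed p k b g by rewrite (agree_proposed _ _ A) /proposed -e.
apply: eq_forallb => b'; rewrite -(agree_proposed _ _ A).
by case: (boolP (proposed p k b' g)) => //= pb'; apply: h2.
Qed.

Lemma agree_single p p' k b : agree p p' k -> single p k b = single p' k b.
Proof. by move=> A; congr (~~ _); apply: eq_existsb => g; apply: agree_engaged. Qed.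

Lemma agree_mover p p' k : agree p p' k -> mover G p k = mover G p' k.
Proof.
move=> A; rewrite /mover (eq_pick (fun b => agree_single b A)).
by rewrite (eq_pick (fun b => agree_engaged b G A)).
Qed.

Lemma agree_step p p' k : agree p p' k -> step G p k = step G p' k.
Proof. by move=> A; apply/ffunP => b; rewrite !ffunE (agree_mover A). Qed.

Definition set_girl p (r : {perm 'I_n}) : profile n :=
  ([ffun g => if g == G then r else p.1 g], p.2).

(* The order of arrival is explored adaptively: the next boy to propose to G is
   determined by the ranks of those who proposed before him. *)
Lemma set_arrival_rank_inj : injective (fun p => set_girl p (arrival_rank p)).
Proof.
move=> p p' [] /ffunP e1 e2.
have eG : arrival_rank p = arrival_rank p' by have := e1 G; rewrite !ffunE eqxx.
have eN g : g != G -> p.1 g = p'.1 g.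
  by move=> /negbTE nG; have := e1 g; rewrite !ffunE nG.
(* Induction on time: equal arrivals so far receive equal ranks from the common [arrival_rank], so
   both profiles answer all queries alike and make the same move. *)
have H t : t <= horizon -> traj p t = traj p' t /\ arrivals p t = arrivals p' t.
  elim: t => [//|t IH tT]; have [et ea] := IH (ltnW tT).
  have rk b : proposed p (traj p t) b G -> p.1 G b = p'.1 G b.
    rewrite -mem_arrivals => bt; rewrite -!arrival_rankE eG.
    congr (arrival_rank p' _).
    apply: val_inj; rewrite /= (index_arrival (ltnW tT) bt).
    by rewrite ea in bt *; rewrite (index_arrival (ltnW tT) bt).
  have A : agree p p' (traj p t).
    split=> [b g j _|g b b' pb pb']; first by rewrite e2.
    by case: (eqVneq g G) pb pb' => [-> pb pb'|/eN -> //]; rewrite !rk.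
  have et' : traj p t.+1 = traj p' t.+1 by rewrite /= (agree_step A) et.
  by split=> //; move: et'; rewrite /= => ->; rewrite ea /proposed e2.
have [_ eT] := H _ (leqnn _).
have eo : arrival p = arrival p'.
  by apply/permP => b; apply/val_inj; rewrite /= !arrivalE /arrival_seq eT.
have eGG : p.1 G = p'.1 G by apply/permP => b; rewrite -!arrival_rankE eG eo.
move: e2 eGG eN; case: p {e1 eG H eT eo} => a c; case: p' => a' c' /= -> eGG eN.
congr pair; apply/ffunP => g; have [->|] := eqVneq g G; [exact: eGG | exact: eN].
Qed.

(** * The coupon-collector estimate *)

Lemma agree_traj p p' t : agree p p' (traj p t) -> traj p' t = traj p t.
Proof.
elim: t => [//|t IH] A.
have A' : agree p p' (traj p t).
  have le b : traj p t b <= traj p t.+1 b by apply: step_ge.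
  case: A => h1 h2; split=> [b g j lt|g b b' l1 l2].
    by apply: h1; apply: leq_trans lt (le b).
  apply: h2; rewrite /proposed; first exact: leq_trans l1 (le b).
  exact: leq_trans l2 (le b').
by rewrite /= IH // (agree_step A').
Qed.

(** The right factor acts on positions: the girls at positions [i] and [j] of the list of [b] change
    places. *)
Definition swap_pos p (b : 'I_n) (i j : 'I_n) : profile n :=
  (p.1, [ffun b' => if b' == b then (p.2 b * tperm i j)%g else p.2 b']).

Lemma swap_posK b i j : involutive (fun p => swap_pos p b i j).
Proof.
case=> a c; congr pair; apply/ffunP => b'; rewrite !ffunE /=.
by have [->|//] := eqVneq b' b; rewrite ?eqxx -mulgA tperm2 mulg1.
Qed.

Lemma agree_swap p b (i j : 'I_n) k :
  k b <= i -> k b <= j -> agree p (swap_pos p b i j) k.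
Proof.
move=> ki kj; split=> // b' g l lk; rewrite ffunE.
have [eb|//] := eqVneq b' b; rewrite permM eb; rewrite eb in lk.
by case: tpermP => [-> | -> | //]; apply/idP/idP => /eqP e; lia.
Qed.

Definition uncourted g t := [set p | ~~ courted p (traj p t) g].

(* Exchanging g with the next girl on the list of the moving boy maps uncourted
   profiles to profiles courting g at the next step; the former position of g,
   one of n values, recovers the original. *)
Lemma uncourted_step g t :
  n * #|uncourted g t.+1| <= n.-1 * #|uncourted g t|.
Proof.
have sub : uncourted g t.+1 \subset uncourted g t.
  apply/subsetP => p; rewrite !inE; apply: contra; exact: courted_traj.
(* At least an [n]-th part of the profiles uncourted so far must become courted at this step. *)
suff: #|uncourted g t| <= n * #|uncourted g t :\: uncourted g t.+1|.
  rewrite cardsD (setIidPr sub); have := subset_leq_card sub.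
  have : 0 < n by apply: leq_ltn_trans (ltn_ord G).
  by move: #|uncourted g t| #|_| => x y; case: n => // n' _; nia.
pose U := uncourted g t :\: uncourted g t.+1.
pose mv p := mover G p (traj p t).
have N p b : p \in uncourted g t -> traj p t b <= p.2 b g.
  by rewrite inE negb_exists => /forallP/(_ b); rewrite -leqNgt.
(* An uncourted [g] still lies ahead on the list of the mover, so his next position is below [n] and
   the default [G] is not taken. *)
pose pos p : 'I_n := insubd G (traj p t (mv p)).
have posE p : p \in uncourted g t -> pos p = traj p t (mv p) :> nat.
  by move=> /N h; rewrite val_insubd (leq_ltn_trans (h _) (ltn_ord _)).
pose sw p := swap_pos p (mv p) (p.2 (mv p) g) (pos p).
have swA p : p \in uncourted g t -> agree p (sw p) (traj p t).
  by move=> pu; apply: agree_swap; [apply: N | rewrite posE].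
have swT p (pu : p \in uncourted g t) : traj (sw p) t = traj p t.
  exact: agree_traj (swA p pu).
have swM p (pu : p \in uncourted g t) : mv (sw p) = mv p.
  by rewrite /mv swT // (agree_mover (swA p pu)).
have swg p : (sw p).2 (mv p) g = pos p.
  by rewrite ffunE eqxx permM tpermL.
pose F p : profile n * 'I_n := (sw p, p.2 (mv p) g).
(* The exchange leaves the trajectory up to [t] unchanged, so the mover and his next position can be
   read off the image. *)
have Finj : {in uncourted g t &, injective F}.
  move=> p p' pu pu' e.
  have e1 : sw p = sw p' := congr1 fst e.
  have e2 : p.2 (mv p) g = p'.2 (mv p') g := congr1 snd e.
  have emv : mv p = mv p' by rewrite -swM // e1 swM.
  have et : traj p t = traj p' t by rewrite -(swT p pu) e1 swT.
  have epos : pos p = pos p' by rewrite /pos emv et.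
  rewrite -(swap_posK (mv p) (p.2 (mv p) g) (pos p) p).
  rewrite -(swap_posK (mv p') (p'.2 (mv p') g) (pos p') p').
  by rewrite -/(sw p) -/(sw p') e1 e2 emv epos.
rewrite -(card_in_imset Finj) mulnC.
have <- : #|setX U [set: 'I_n]| = #|U| * n by rewrite cardsX cardsT card_ord.
apply/subset_leq_card/subsetP => _ /imsetP[p pu ->].
have nc : ~~ complete p (traj p t).
  move: pu; rewrite inE; apply: contra => cp.
  by apply/taken_courted/complete_taken.
rewrite inE [_.2 \in _]inE andbT /= !inE negbK; apply/andP; split; last first.
  rewrite swT //; move: (pu); rewrite inE; apply: contra => /existsP[b h].
  by apply/existsP; exists b; rewrite (agree_proposed _ _ (swA p pu)).
apply/existsP; exists (mv p); rewrite /proposed swg.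
have -> : traj (sw p) t.+1 = step G p (traj p t).
  by rewrite (agree_step (swA p pu)) -(swT p pu).
by rewrite ffunE eqxx /= -(posE p pu) ltn_ord.
Qed.

Lemma card_uncourted g t : n ^ t * #|uncourted g t| <= n.-1 ^ t * #|profile n|.
Proof.
elim: t => [|t IH]; first by rewrite !mul1n max_card.
rewrite !expnS -mulnA [n * _]mulnC -mulnA [#|_| * n]mulnC.
apply: leq_trans (_ : n ^ t * (n.-1 * #|uncourted g t|) <= _).
  by rewrite leq_mul2l uncourted_step orbT.
by rewrite mulnCA -mulnA leq_mul2l IH orbT.
Qed.

Definition no_stable_rank_sum t :=
  [set p | ~~ [exists m : {perm 'I_n}, stable p m && (husband_rank_sum p m <= t)]].

(** Union bound over the girls: if all are courted by time [t], [courted_stable] supplies the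
    matching. *)
Lemma card_no_stable_rank_sum t :
  n ^ t * #|no_stable_rank_sum t| <= n * n.-1 ^ t * #|profile n|.
Proof.
have sub : no_stable_rank_sum t \subset \bigcup_g uncourted g t.
  apply/subsetP => p; rewrite inE; apply: contraR => h.
  have [|m sm mt] := @courted_stable n G p t; last first.
    by apply/existsP; exists m; rewrite sm.
  move=> g; apply: contraR h => nc; apply/bigcupP; exists g => //.
  by rewrite inE.
apply: leq_trans (_ : n ^ t * \sum_g #|uncourted g t| <= _).
  rewrite leq_mul2l; apply/orP; right.
  apply: leq_trans (subset_leq_card sub) _.
  elim/big_ind2: _ => [|A a B b' h1 h2|//]; first by rewrite cards0.
  by rewrite (leq_trans (leq_card_setU _ _)) // leq_add.
rewrite big_distrr /= -mulnA -[X in _ <= X * _](card_ord n) -sum_nat_const.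
by apply: leq_sum => g _; apply: card_uncourted.
Qed.

End Arrival.

(** * Symmetries of the random profile *)

Section Symmetry.
Variable n : nat.
Implicit Types (p : profile n) (b g : 'I_n) (m s : {perm 'I_n}).

Lemma stableP p m :
  reflect (forall g b, p.1 g b < p.1 g (m g) ->
             p.2 b ((m^-1)%g b) <= p.2 b g)
          (stable p m).
Proof.
apply: (iffP idP) => [sm g b lt|h].
  rewrite leqNgt; apply: contra sm => lt'.
  by apply/existsP; exists g; apply/existsP; exists b; apply/andP.
apply/negP => /existsP[g /existsP[b /andP[/h]]].
by rewrite leqNgt => /negP h1 /h1.
Qed.

(** Girl [g] of the new profile is girl [s g] of the old one, so a matching [m] becomes [s * m]. *)
Definition relabel s p : profile n :=
  ([ffun g => p.1 (s g)], [ffun b => s * p.2 b]%g).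

Lemma relabelK s : involutive s -> involutive (relabel s).
Proof.
move=> sK [a c]; congr pair; apply/ffunP => x; rewrite !ffunE ?sK //=.
by apply/permP => y; rewrite !permM sK.
Qed.

Lemma stable_relabel s p m : stable (relabel s p) (s * m)%g = stable p m.
Proof.
apply/stableP/stableP => h g b.
  have := h ((s^-1)%g g) b; rewrite !ffunE !permM permKV.
  by rewrite invMg permM permKV.
rewrite !ffunE !permM invMg permM permKV; exact: h.
Qed.

Lemma exists_stable_relabel s p (R R' : pred {perm 'I_n}) :
  (forall m, R (s * m)%g = R' m) ->
  [exists m, stable (relabel s p) m && R m] = [exists m, stable p m && R' m].
Proof.
move=> RR; apply/existsP/existsP => -[m /andP[sm rm]]; last first.
  by exists (s * m)%g; rewrite stable_relabel sm RR.
by exists (s^-1 * m)%g; rewrite -(stable_relabel s) -RR mulgA mulgV mul1g sm.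
Qed.

Lemma suitors_relabel s p m g :
  suitors (relabel s p) (s * m)%g g = suitors p m (s g).
Proof.
congr #|pred_of_set _|; apply/setP => b; rewrite !inE !ffunE !permM.
by rewrite invMg permM permKV.
Qed.

Definition flip p : profile n := (p.2, p.1).

Lemma stable_flip p m : stable (flip p) m = stable p (m^-1)%g.
Proof.
apply/stableP/stableP => /= h b g; rewrite ?invgK => lt.
  by rewrite leqNgt; apply/negP => /h; rewrite leqNgt lt.
by rewrite leqNgt; apply/negP => /h; rewrite invgK leqNgt lt.
Qed.

(** Double counting: a boy is a suitor of exactly the girls on his list down to his wife. *)
Lemma sum_suitors p m :
  \sum_g suitors p m g = husband_rank_sum p m.
Proof.
rewrite /suitors (eq_bigr (fun g =>
  \sum_(b | p.2 b g <= p.2 b ((m^-1)%g b)) 1)); last first.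
  by move=> g _; rewrite sum1_card; apply: eq_card => b; rewrite !inE.
rewrite (exchange_big_dep predT) //=; apply: eq_bigr => b _.
set x := p.2 b _.
rewrite (reindex_inj (@perm_inj _ (p.2 b)^-1%g)) /=.
rewrite (eq_bigl (fun i : 'I_n => i <= x)) => [|i]; last by rewrite permKV.
rewrite -(big_mkord (fun i => i <= x) (fun=> 1)).
have <- := big_nat_widen 0 x.+1 n predT (fun=> 1) (ltn_ord x).
by rewrite sum_nat_const_nat subn0 muln1.
Qed.

(** Markov's inequality for the counting measure. *)
Lemma sum_mul_count (I : finType) (F : I -> nat) a :
  a.+1 * #|[set i | a < F i]| <= \sum_i F i.
Proof.
rewrite mulnC -sum_nat_const [X in _ <= X](bigID (fun i => a < F i)) /=.
apply: leq_trans (leq_addr _ _).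
rewrite (eq_bigl (fun i => a < F i)) => [|i]; last by rewrite inE.
exact: leq_sum.
Qed.

(** By relabelling, every girl is bad in equally many profiles, so the pairs of a profile and a bad
    girl are counted. A profile in [N] may have all [n] girls bad, any other has at most
    [T / (a + 1)]. *)
Lemma card_bad_girl (Q : 'I_n -> pred (profile n)) (N : {set profile n})
    (a T : nat) (G : 'I_n) :
  (forall s p g, Q g (relabel s p) = Q (s g) p) ->
  (forall p, p \notin N -> a.+1 * #|[set g | Q g p]| <= T) ->
  a.+1 * (n * #|[set p | Q G p]|) <= a.+1 * (n * #|N|) + T * #|profile n|.
Proof.
move=> Qs Qle.
have e g : #|[set p | Q g p]| = #|[set p | Q G p]|.
  have inv : involutive (relabel (tperm g G)) by apply/relabelK/tpermK.
  rewrite -(card_preimset _ (inv_inj inv)); apply: eq_card => p.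
  by rewrite !inE Qs tpermL.
have -> : n * #|[set p | Q G p]| = \sum_p #|[set g | Q g p]|.
  rewrite -[X in X * _](card_ord n) -sum_nat_const.
  rewrite (eq_bigr (fun g => \sum_(p | Q g p) 1)); last first.
    by move=> g _; rewrite -(e g) -sum1dep_card.
  rewrite (exchange_big_dep predT) //=; apply: eq_bigr => p _.
  by rewrite sum1dep_card.
rewrite (bigID (mem N)) /= mulnDr; apply: leq_add.
  rewrite leq_mul2l -[X in _ <= X]mulnC -sum_nat_const; apply/orP; right.
  by apply: leq_sum => p _; rewrite -[X in _ <= X](card_ord n) max_card.
rewrite big_distrr /=.
apply: leq_trans (_ : \sum_(p | p \notin N) T <= _); first exact: leq_sum.
by rewrite sum_nat_const mulnC leq_mul2l max_card orbT.
Qed.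

Definition many_suitors a g p :=
  ~~ [exists m : {perm 'I_n}, stable p m && (suitors p m g <= a)].

Definition poor_husbands a g p :=
  ~~ [exists m : {perm 'I_n}, stable p m && (p.1 g (m g) <= a)].

Lemma card_many_suitors a T (G : 'I_n) :
  a.+1 * (n * #|[set p | many_suitors a G p]|)
    <= a.+1 * (n * #|no_stable_rank_sum n T|) + T * #|profile n|.
Proof.
apply: card_bad_girl => [s p g|p].
  congr (~~ _); apply: exists_stable_relabel => m.
  by rewrite suitors_relabel.
rewrite inE negbK => /existsP[m /andP[sm mT]].
apply: leq_trans mT; rewrite -sum_suitors.
apply: leq_trans (sum_mul_count _ a); rewrite leq_mul2l.
apply/orP; right; apply/subset_leq_card/subsetP => g; rewrite !inE.
by rewrite ltnNge; apply: contra => h; apply/existsP; exists m; rewrite sm.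
Qed.

(** Exchanging the sexes turns the rank sum into one over the girls' rankings of their husbands;
    [flip] preserves the size of the exceptional set. *)
Lemma card_poor_husbands a T (G : 'I_n) :
  a.+1 * (n * #|[set p | poor_husbands a G p]|)
    <= a.+1 * (n * #|no_stable_rank_sum n T|) + T * #|profile n|.
Proof.
have fI : injective flip by move=> [x y] [x' y'] [-> ->].
rewrite -(card_preimset (no_stable_rank_sum n T) fI).
apply: card_bad_girl => [s p g|p].
  by congr (~~ _); apply: exists_stable_relabel => m; rewrite ffunE permM.
rewrite !inE negbK => /existsP[m /andP[sm mT]].
rewrite stable_flip in sm; apply: leq_trans mT.
apply: leq_trans (_ : _ <= \sum_g (p.1 g ((m^-1)%g g))) _; last by apply: leq_sum.
apply: leq_trans (sum_mul_count _ a); rewrite leq_mul2l.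
apply/orP; right; apply/subset_leq_card/subsetP => g; rewrite !inE.
by rewrite ltnNge; apply: contra => h; apply/existsP; exists (m^-1)%g; rewrite sm.
Qed.

End Symmetry.

(** * Records of a uniform permutation *)

Section Records.
Variable n : nat.
Implicit Types (s : {perm 'I_n}) (i j l : 'I_n).

(* Exactly one transposition moves the minimum of the first i + 1 values of s to
   position i. *)
Lemma card_record_swap s i :
  #|[set l : 'I_n | (l <= i) && record (tperm l i * s)%g i]| = 1.
Proof.
case: (@arg_minnP _ i (fun l : 'I_n => l <= i) (fun l => s l)) => // l0 l0i min.
apply/eqP/cards1P; exists l0; apply/setP => l; rewrite !inE.
apply/andP/eqP => [[li /forall_inP rl]|->]; last first.
  split=> //; apply/forall_inP => j ji; rewrite !permM tpermR.
  rewrite ltn_neqAle min ?andbT.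
    rewrite (inj_eq val_inj) (inj_eq perm_inj).
    apply: contraTneq ji => e; rewrite -leqNgt.
    by move: e => /(congr1 (tperm l0 i)); rewrite tpermK tpermL => <-.
  by case: tpermP => [_|_|_ _] //; apply: ltnW.
apply/eqP; apply: contraT => nl.
have l0i' : tperm l i l0 < i.
  case: tpermP nl => [-> | e | _ ne _].
  - by rewrite eqxx.
  - by move=> nl; rewrite ltn_neqAle li andbT -e.
  - by rewrite ltn_neqAle l0i andbT; apply/eqP => /val_inj.
by have := rl _ l0i'; rewrite !permM tpermR tpermK ltnNge min.
Qed.

(** Averaging over the transpositions of [i] with the [i + 1] positions up to [i]: all preserve [A],
    and for each permutation exactly one of them creates a record at [i]. *)
Lemma card_record (A : {set {perm 'I_n}}) i :
  (forall l s, l <= i -> ((tperm l i * s)%g \in A) = (s \in A)) ->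
  i.+1 * #|[set s in A | record s i]| = #|A|.
Proof.
move=> AI.
have e l : l <= i ->
    #|[set s in A | record (tperm l i * s)%g i]| = #|[set s in A | record s i]|.
  move=> li; have inj := @mulgI _ (tperm l i).
  rewrite -[RHS](card_preimset _ inj); apply: eq_card => s.
  by rewrite !inE AI.
have <- : #|[set l : 'I_n | l <= i]| = i.+1.
  rewrite -sum1dep_card -(big_mkord (fun x => x <= i) (fun=> 1)).
  rewrite (eq_bigl (fun x => x < i.+1)) //.
  have <- := big_nat_widen 0 i.+1 n predT (fun=> 1) (ltn_ord i).
  by rewrite sum_nat_const_nat subn0 muln1.
rewrite -sum_nat_const (eq_bigr (fun l =>
  \sum_(s | (s \in A) && record (tperm l i * s)%g i) 1)); last first.
  by move=> l; rewrite inE => li; rewrite -(e l li) sum1dep_card.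
rewrite (exchange_big_dep (fun s => s \in A)) /=; last by move=> l s _ /andP[].
rewrite -sum1_card; apply: eq_bigr => s sA; rewrite sum1dep_card.
rewrite -[RHS](card_record_swap s i); apply: eq_card => l.
by rewrite !inE sA.
Qed.

Lemma card_record1 i : i.+1 * #|[set s | record s i]| = n`!.
Proof.
rewrite -card_Sn -cardsT -(@card_record setT i) => [|l s _]; last by rewrite !inE.
by congr (_ * _); apply: eq_card => s; rewrite !inE.
Qed.

(** The value at [j] and the set of values before it do not change. *)
Lemma record_swap s i j l : l <= i < j ->
  record (tperm l i * s)%g j = record s j.
Proof.
case/andP=> li ij; have lj := leq_ltn_trans li ij.
have h t : record t j -> record (tperm l i * t)%g j.
  move=> /forall_inP r; apply/forall_inP => x xj; rewrite !permM.
  rewrite [in X in X < _]tpermD; first by apply: r; case: tpermP.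
    by apply: contraTneq lj => ->; rewrite ltnn.
  by apply: contraTneq ij => ->; rewrite ltnn.
by apply/idP/idP => [/h|/h //]; rewrite mulgA tperm2 mul1g.
Qed.

(** Pairwise independence: a record at the later position is unaffected by transpositions up to the
    earlier one, so [card_record] applies to the permutations with that record. *)
Lemma card_record2 i j : i != j ->
  i.+1 * (j.+1 * #|[set s | record s i && record s j]|) = n`!.
Proof.
wlog ij : i j / i < j.
  move=> W; rewrite neq_ltn => /orP[ij|ji].
    by apply: W; rewrite ?ij // neq_ltn ij.
  rewrite mulnCA -(W j i) // ?neq_ltn ?ji //.
  by congr (_ * (_ * _)); apply: eq_card => s; rewrite !inE andbC.
move=> _; rewrite mulnCA -(card_record1 j); congr (_ * _).
rewrite -(@card_record [set s | record s j] i) => [|l s li].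
  by congr (_ * _); apply: eq_card => s; rewrite !inE andbC.
by rewrite !inE record_swap // li.
Qed.

(** Union bound over the first [K] positions; by symmetry each has a rank up to [r] with probability
    at most [(r + 1) / n]. *)
Lemma card_early_low K r :
  n * #|[set s : {perm 'I_n} | [exists i : 'I_n, (i < K) && (s i <= r)]]|
    <= K * (r.+1 * n`!).
Proof.
have low m (P : nat -> bool) :
    (forall i, P i -> i < m) -> #|[set i : 'I_n | P i]| <= m.
  move=> Pm; apply: leq_trans (_ : size (iota 0 m) <= m); last by rewrite size_iota.
  rewrite cardE -(size_map val); apply: uniq_leq_size.
    by rewrite map_inj_uniq ?enum_uniq //; apply: val_inj.
  by move=> _ /mapP[i +->]; rewrite mem_enum inE mem_iota => /Pm.
pose low_at i := [set s : {perm 'I_n} | s i <= r].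
have e i i' : #|low_at i| = #|low_at i'|.
  have inj := @mulgI _ (tperm i i').
  rewrite -[RHS](card_preimset _ inj); apply: eq_card => s.
  by rewrite !inE permM tpermR.
have b i : n * #|low_at i| <= r.+1 * n`!.
  have -> : n * #|low_at i| = \sum_(s : {perm 'I_n}) #|[set j | s j <= r]|.
    rewrite -[X in X * _](card_ord n) -sum_nat_const.
    rewrite (eq_bigr (fun j => \sum_(s : {perm 'I_n} | s j <= r) 1)); last first.
      by move=> j _; rewrite (e i j) sum1dep_card.
    rewrite (exchange_big_dep predT) //=; apply: eq_bigr => s _.
    by rewrite sum1dep_card.
  rewrite mulnC -card_Sn -sum_nat_const.
  apply: leq_sum => s _.
  rewrite -(card_imset _ (@perm_inj _ s)).
  apply: leq_trans (low r.+1 (fun x => x <= r) _) => [|//].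
  by apply/subset_leq_card/subsetP => _ /imsetP[j + ->]; rewrite !inE.
apply: leq_trans (_ : \sum_(i : 'I_n | i < K) n * #|low_at i| <= _).
  rewrite -big_distrr leq_mul2l; apply/orP; right.
  apply: leq_trans (_ : #|\bigcup_(i : 'I_n | i < K) low_at i| <= _).
    apply/subset_leq_card/subsetP => s; rewrite inE => /existsP[i /andP[iK sr]].
    by apply/bigcupP; exists i => //; rewrite inE.
  elim/big_ind2: _ => [|A x B y h1 h2|//]; first by rewrite cards0.
  by rewrite (leq_trans (leq_card_setU _ _)) // leq_add.
apply: leq_trans (_ : \sum_(i : 'I_n | i < K) r.+1 * n`! <= _).
  by apply: leq_sum => i _; apply: b.
rewrite sum_nat_cond_const leq_mul2r; apply/orP; right.
by exact: (low K (fun x => x < K)).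
Qed.

(** The injective map of [set_arrival_rank_inj] permutes the profiles and makes [arrival_rank]
    equidistributed with the ranking of [G], which is uniform because it may be translated by any
    [t]. *)
Lemma card_arrival_rank G (B : {set {perm 'I_n}}) :
  n`! * #|[set p : profile n | arrival_rank G p \in B]| = #|B| * #|profile n|.
Proof.
have <- : #|[set p : profile n | p.1 G \in B]| =
          #|[set p : profile n | arrival_rank G p \in B]|.
  rewrite -(card_preimset _ (@set_arrival_rank_inj n G)); apply: eq_card => p.
  by rewrite !inE /= ffunE eqxx.
have e (t : {perm 'I_n}) : #|[set p : profile n | (t * p.1 G)%g \in B]|
    = #|[set p : profile n | p.1 G \in B]|.
  pose f (p : profile n) := set_girl G p (t * p.1 G)%g.
  have inj : injective f.
    pose f' (p : profile n) := set_girl G p (t^-1 * p.1 G)%g.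
    apply: (can_inj (g := f')) => -[a c]; congr pair; apply/ffunP => g.
    rewrite !ffunE /=; have [->|//] := eqVneq g G.
    by rewrite eqxx mulgA mulVg mul1g.
  rewrite -[RHS](card_preimset _ inj); apply: eq_card => p.
  by rewrite !inE /= ffunE eqxx.
rewrite -card_Sn -[LHS]sum_nat_const.
rewrite (eq_bigr (fun t => \sum_(p : profile n | (t * p.1 G)%g \in B) 1)); last first.
  by move=> t _; rewrite -(e t) sum1dep_card.
rewrite (exchange_big_dep predT) //= mulnC -sum_nat_const.
apply: eq_big => [//|p _]; rewrite sum1dep_card.
rewrite -[RHS](card_preimset _ (@mulIg _ (p.1 G))); apply: eq_card => t.
by rewrite !inE.
Qed.

End Records.

(** * Chebyshev's inequality for the number of records *)

Section Chebyshev.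
Local Open Scope ring_scope.
Variables (R : realFieldType) (n : nat).
Implicit Types (s : {perm 'I_n}) (i j : 'I_n).

(** The expected number of records at positions in [S]. *)
Definition harmonic_sum (S : {set 'I_n}) : R := \sum_(i in S) i.+1%:R^-1.

Definition record_count (S : {set 'I_n}) s := #|[set i in S | record s i]|.

Lemma record_countE S s :
  (record_count S s)%:R = \sum_(i in S) (record s i)%:R :> R.
Proof.
rewrite /record_count -sum1dep_card natr_sum big_mkcondr /=.
by apply: eq_bigr => i _; case: (record s i).
Qed.

Lemma sum_record i : \sum_s (record s i)%:R = n`!%:R / i.+1%:R :> R.
Proof.
rewrite -(card_record1 i) natrM mulrC mulKf ?pnatr_eq0 //.
rewrite -sum1dep_card natr_sum [RHS]big_mkcond; apply: eq_bigr => s _.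
by case: (record s i).
Qed.

Lemma sum_record2 i j : i != j ->
  \sum_s (record s i)%:R * (record s j)%:R = n`!%:R / i.+1%:R / j.+1%:R :> R.
Proof.
have i0 : i.+1%:R != 0 :> R by rewrite pnatr_eq0.
have j0 : j.+1%:R != 0 :> R by rewrite pnatr_eq0.
move=> ij; rewrite -(card_record2 ij) !natrM.
rewrite [RHS](_ : _ = #|[set s | record s i && record s j]|%:R); last first.
  by move: (i.+1%:R : R) (j.+1%:R : R) i0 j0 => x y x0 y0; field; rewrite x0 y0.
rewrite -sum1dep_card natr_sum [RHS]big_mkcond; apply: eq_bigr => s _.
by rewrite -natrM mulnb; case: (_ && _).
Qed.

(** Off the diagonal the covariance vanishes by pairwise independence; on it, the variance
    [u - u ^ 2] is at most the probability [u] of a record. *)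
Lemma sum_record_cov i j :
  \sum_s ((record s i)%:R - i.+1%:R^-1) * ((record s j)%:R - j.+1%:R^-1)
    <= (i == j)%:R * (n`!%:R / i.+1%:R) :> R.
Proof.
have cS : \sum_(s : {perm 'I_n}) (1 : R) = n`!%:R.
  by rewrite sumr_const card_Sn.
set u : R := i.+1%:R^-1; set v : R := j.+1%:R^-1.
have -> : \sum_s ((record s i)%:R - u) * ((record s j)%:R - v) =
   \sum_s (record s i)%:R * (record s j)%:R - v * (\sum_s (record s i)%:R)
   - u * (\sum_s (record s j)%:R) + u * v * n`!%:R.
  rewrite -cS !mulr_sumr -!sumrB -big_split /=.
  by apply: eq_bigr => s _; ring.
rewrite !sum_record -/u -/v.
have [e|ij] := eqVneq i j; last first.
  by rewrite sum_record2 // -/u -/v mul0r le_eqVlt; apply/orP; left; apply/eqP; ring.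
rewrite mul1r -/u -(_ : u = v) ?/u ?e //.
under eq_bigr do rewrite -natrM mulnb andbb.
rewrite sum_record.
set w : R := j.+1%:R^-1.
have : 0 <= n`!%:R * w * w by rewrite !mulr_ge0 ?invr_ge0 ?ler0n.
nra.
Qed.

Lemma record_count_variance (S : {set 'I_n}) :
  \sum_s ((record_count S s)%:R - harmonic_sum S) ^+ 2 <= n`!%:R * harmonic_sum S.
Proof.
have -> : \sum_s ((record_count S s)%:R - harmonic_sum S) ^+ 2 =
  \sum_(i in S) \sum_(j in S) \sum_s ((record s i)%:R - i.+1%:R^-1)
                                   * ((record s j)%:R - j.+1%:R^-1).
  under [RHS]eq_bigr do rewrite exchange_big /=.
  rewrite exchange_big /=; apply: eq_bigr => s _.
  rewrite record_countE -sumrB expr2 big_distrl /=.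
  by apply: eq_bigr => i _; rewrite big_distrr.
rewrite mulr_sumr; apply: ler_sum => i iS.
apply: le_trans (_ : \sum_(j in S) (i == j)%:R * (n`!%:R / i.+1%:R) <= _).
  by apply: ler_sum => j _; apply: sum_record_cov.
rewrite (bigD1 i) //= eqxx mul1r big1 ?addr0 // => j /andP[_ /negbTE].
by rewrite eq_sym => ->; rewrite mul0r.
Qed.

Lemma record_count_chebyshev (S : {set 'I_n}) (d : R) : 0 < d ->
  #|[set s | d <= `|(record_count S s)%:R - harmonic_sum S|]|%:R * d ^+ 2
    <= n`!%:R * harmonic_sum S.
Proof.
move=> d0; apply: le_trans (record_count_variance S).
set f := fun s => (record_count S s)%:R - harmonic_sum S.
rewrite [leRHS](bigID (fun s => d <= `|f s|)) /= -[leLHS]addr0.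
apply: lerD; last by apply: sumr_ge0 => s _; apply: sqr_ge0.
rewrite -sum1dep_card natr_sum big_distrl /=; apply: ler_sum => s ds.
by rewrite mul1r -[leRHS]real_normK ?num_real // lerXn2r ?nnegrE ?normr_ge0 // ltW.
Qed.

End Chebyshev.

(** * Probabilities of the bad events *)

Local Open Scope ring_scope.

Section Probability.
Variables (R : realFieldType) (n : nat).
Implicit Types (E F : {set profile n}).

Lemma card_profile : #|profile n|%:R = (n`!%:R ^+ n * n`!%:R ^+ n : R).
Proof. by rewrite /profile card_prod !card_ffun card_Sn card_ord natrM !natrX. Qed.

(** The product of uniform laws gives all profiles the same weight. *)
Lemma PrE E : Pr R E = #|E|%:R / #|profile n|%:R.
Proof.
rewrite /Pr /profile_weight /uniform_weight.
under eq_bigr do rewrite !prodr_const card_ord.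
by rewrite sumr_const card_profile invfM !exprVn -[LHS]mulr_natl.
Qed.

Lemma card_profile_gt0 : 0 < #|profile n|%:R :> R.
Proof. by rewrite card_profile mulr_gt0 ?exprn_gt0 ?ltr0n ?fact_gt0. Qed.

Lemma Pr_le1 E : Pr R E <= 1.
Proof. by rewrite PrE ler_pdivrMr ?card_profile_gt0 // mul1r ler_nat max_card. Qed.

Lemma PrC E : Pr R (~: E) = 1 - Pr R E.
Proof.
rewrite !PrE cardsCs setCK natrB ?max_card // mulrBl divff //.
exact/lt0r_neq0/card_profile_gt0.
Qed.

Lemma Pr_mono E F : E \subset F -> Pr R E <= Pr R F.
Proof.
move=> EF; rewrite !PrE ler_pM2r ?invr_gt0 ?card_profile_gt0 // ler_nat.
exact: subset_leq_card.
Qed.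

Lemma PrU E F : Pr R (E :|: F) <= Pr R E + Pr R F.
Proof.
rewrite !PrE -mulrDl ler_pM2r ?invr_gt0 ?card_profile_gt0 // -natrD ler_nat.
exact: leq_card_setU.
Qed.

Lemma Pr_arrival_rank (G : 'I_n) (B : {set {perm 'I_n}}) :
  Pr R [set p | arrival_rank G p \in B] = #|B|%:R / n`!%:R.
Proof.
have f0 : n`!%:R != 0 :> R by rewrite pnatr_eq0 -lt0n fact_gt0.
apply: (mulfI f0); rewrite PrE mulrA -natrM card_arrival_rank natrM.
rewrite mulfK ?lt0r_neq0 ?card_profile_gt0 //.
by rewrite mulrCA divff // mulr1.
Qed.

Lemma Pr_no_stable_rank_sum T : (0 < n)%N ->
  Pr R (no_stable_rank_sum n T) <= n%:R * (1 - n%:R^-1) ^+ T.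
Proof.
move=> n0; have nR : 0 < n%:R :> R by rewrite ltr0n.
have -> : 1 - n%:R^-1 = n.-1%:R / n%:R :> R.
  by rewrite -[in RHS](subn1 n) natrB // mulrBl mul1r divff ?lt0r_neq0.
rewrite PrE ler_pdivrMr ?card_profile_gt0 // expr_div_n mulrA.
rewrite mulrAC ler_pdivlMr ?exprn_gt0 // mulrC -!natrX -!natrM ler_nat.
exact: (card_no_stable_rank_sum (Ordinal n0)).
Qed.

Lemma Pr_bad_girl E a T : (0 < n)%N ->
  (a.+1 * (n * #|E|)
     <= a.+1 * (n * #|no_stable_rank_sum n T|) + T * #|profile n|)%N ->
  Pr R E <= n%:R * (1 - n%:R^-1) ^+ T + T%:R / (n%:R * a.+1%:R).
Proof.
move=> n0 le; apply: le_trans (lerD (Pr_no_stable_rank_sum T n0) (lexx _)).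
have na : 0 < n%:R * a.+1%:R :> R by rewrite mulr_gt0 ?ltr0n.
rewrite !PrE ler_pdivrMr ?card_profile_gt0 // mulrDl.
rewrite divfK ?lt0r_neq0 ?card_profile_gt0 // -(ler_pM2l na) mulrDr.
rewrite [X in _ <= _ + X]mulrA [X in _ <= _ + X * _]mulrCA divff ?lt0r_neq0 // mulr1.
by rewrite -!natrM -natrD ler_nat ![(n * a.+1)%N]mulnC -!mulnA.
Qed.

(** Five bad events are excluded: [G] has more than [a] suitors in every stable matching; she has no
    stable husband among her [a + 1] favourites; one of these is among the first [K] arrivals; one
    of two record counts is off by [d]. The count over all positions serves the upper bound, the one
    from [a] to [K] the lower. *)
Lemma Pr_stable_husbands (G : 'I_n) a K T (lo hi d : R) :
  let H := harmonic_sum R [set: 'I_n] in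
  let M := harmonic_sum R [set i : 'I_n | (a <= i < K)%N] in
  0 < d -> d <= hi - H -> d <= M - lo ->
  1 - Pr R [set p | (lo <= #|stable_husbands p G|%:R)
                    && (#|stable_husbands p G|%:R <= hi)]
  <= 2 * (n%:R * (1 - n%:R^-1) ^+ T + T%:R / (n%:R * a.+1%:R))
     + K%:R * a.+1%:R / n%:R + (H + M) / d ^+ 2.
Proof.
move=> H M d0 dH dM; have n0 : (0 < n)%N by apply: leq_ltn_trans (ltn_ord G).
pose B1 := [set p | many_suitors a G p].
pose B2 := [set p | poor_husbands a G p].
pose B3 := [set s : {perm 'I_n} | [exists i : 'I_n, (i < K)%N && (s i <= a)%N]].
pose Bd S := [set s : {perm 'I_n} |
  d <= `|(record_count S s)%:R - harmonic_sum R S|].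
pose S := [set i : 'I_n | (a <= i < K)%N].
pose ar (B : {set {perm 'I_n}}) := [set p | arrival_rank G p \in B].
have sub : ~: [set p | (lo <= #|stable_husbands p G|%:R)
                    && (#|stable_husbands p G|%:R <= hi)]
  \subset B1 :|: B2 :|: ar B3 :|: (ar (Bd setT) :|: ar (Bd S)).
  apply/subsetP => p; rewrite 2!inE; apply: contraR.
  rewrite /ar /Bd /B1 /B2 /B3 !inE !negb_or.
  case/andP=> /andP[/andP[/negPn e1 /negPn e2] e3] /andP[e4 e5].
  case/existsP: e1 => m /andP[sm me]; case/existsP: e2 => m' /andP[sm' me'].
  rewrite -!ltNge in e4 e5.
  apply/andP; split.
    have hK (i : 'I_n) : (i < K)%N -> (a < arrival_rank G p i)%N.
      move: e3; rewrite negb_exists => /forallP/(_ i).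
      by rewrite negb_and => + iK; rewrite iK /= -ltnNge.
    have := card_stable_husbands_ge sm me sm' me' hK.
    have -> : #|[set i : 'I_n | [&& a <= i, i < K & record (arrival_rank G p) i]]%N|
        = record_count S (arrival_rank G p).
      by apply: eq_card => i; rewrite !inE andbA.
    rewrite -(ler_nat R) => le; apply: le_trans le.
    move: e5; rewrite ltr_distl -/M => /andP[l _].
    by lra.
  have := card_stable_husbands_le G p.
  have -> : #|[set i : 'I_n | record (arrival_rank G p) i]|
        = record_count setT (arrival_rank G p).
    by apply: eq_card => i; rewrite !inE.
  rewrite -(ler_nat R) => le; apply: le_trans le _.
  move: e4; rewrite ltr_distl -/H => /andP[_ l].
  by lra.
have PBd (Q : {set 'I_n}) : Pr R (ar (Bd Q)) <= harmonic_sum R Q / d ^+ 2.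
  have f0 : 0 < n`!%:R :> R by rewrite ltr0n fact_gt0.
  rewrite /ar Pr_arrival_rank ler_pdivrMr // mulrAC ler_pdivlMr ?exprn_gt0 //.
  by rewrite [leRHS]mulrC; apply: record_count_chebyshev.
have PB3 : Pr R (ar B3) <= K%:R * a.+1%:R / n%:R.
  have f0 : 0 < n`!%:R :> R by rewrite ltr0n fact_gt0.
  rewrite /ar Pr_arrival_rank ler_pdivrMr // mulrAC ler_pdivlMr ?ltr0n //.
  rewrite -!natrM ler_nat mulnC -mulnA; exact: card_early_low.
rewrite -PrC; apply: le_trans (Pr_mono sub) _.
apply: le_trans (PrU _ _) _; rewrite [(H + M) / _]mulrDl.
apply: lerD; last exact: le_trans (PrU _ _) (lerD (PBd _) (PBd _)).
apply: le_trans (PrU _ _) _; apply: lerD => //.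
apply: le_trans (PrU _ _) _; rewrite mulr_natl mulr2n.
apply: lerD; apply: Pr_bad_girl => //.
  exact: card_many_suitors.
exact: card_poor_husbands.
Qed.

End Probability.

(* Logarithmic estimates and choice of the parameters *)
From mathcomp Require Import all_classical all_reals all_analysis.
Import Order.TTheory GRing.Theory Num.Theory.
Import numFieldNormedType.Exports.

Lemma exists_tenth_root N : (0 < N)%N -> exists w, (w ^ 10 <= N < w.+1 ^ 10)%N.
Proof.
move=> N0; have ex : exists w, (w ^ 10 <= N)%N by exists 0%N.
have bd w : (w ^ 10 <= N -> w <= N)%N.
  apply: leq_trans; case: w => // w.
  by rewrite -[X in (X <= _)%N]expn1 leq_pexp2l.
case: (ex_maxnP ex bd) => w wN max; exists w; rewrite wN ltnNge /=.
by apply/negP => /max; rewrite ltnn.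
Qed.

Section Estimates.
Variable R : realType.
Implicit Types (c C d : R).

(** Both bounds are instances of [ln (1 + x) <= x], for the ratio of the two numbers and its
    inverse. *)
Lemma lnS_diff_bounds i :
  i.+2%:R^-1 <= ln (i.+2%:R : R) - ln (i.+1%:R : R) <= i.+1%:R^-1.
Proof.
have x1 : 0 < i.+1%:R :> R by rewrite ltr0n.
have x2 : 0 < i.+2%:R :> R by rewrite ltr0n.
have e : i.+2%:R = i.+1%:R + 1 :> R by rewrite -natr1.
apply/andP; split.
  rewrite -lerN2 opprB -ln_div ?posrE //.
  have -> : i.+1%:R / i.+2%:R = 1 + - i.+2%:R^-1 :> R.
    by move: x2; rewrite e => x2; field; rewrite lt0r_neq0.
  apply: le_ln1Dx; rewrite ltrN2 invf_lt1 // ltr1n //.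
rewrite -ln_div ?posrE //.
have -> : i.+2%:R / i.+1%:R = 1 + i.+1%:R^-1 :> R.
  by rewrite e; field; rewrite lt0r_neq0.
by apply: le_ln1Dx; apply: lt_trans (_ : 0 < _); rewrite ?invr_gt0 // oppr_lt0.
Qed.

Lemma harmonic_sum_le n : harmonic_sum R [set: 'I_n.+1] <= 1 + ln n.+1%:R.
Proof.
rewrite /harmonic_sum (eq_bigl predT) => [|i]; last by rewrite inE.
rewrite -(big_mkord predT (fun i => i.+1%:R^-1 : R)).
elim: n => [|n IH]; first by rewrite big_nat1 ln1 addr0 invr1.
rewrite big_nat_recr //=; have /andP[h _] := lnS_diff_bounds n.
by apply: le_trans (lerD IH h) _; rewrite -addrA subrKC.
Qed.

Lemma harmonic_sum_ge n a K : (a <= K <= n)%N ->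
  ln K.+1%:R - ln a.+1%:R <= harmonic_sum R [set i : 'I_n | (a <= i < K)%N]%SET.
Proof.
case/andP=> aK Kn.
have -> : harmonic_sum R [set i : 'I_n | (a <= i < K)%N]%SET
    = \sum_(a <= i < K) i.+1%:R^-1.
  rewrite (big_nat_widen _ _ _ _ _ Kn) (big_nat_widenl a 0) // big_mkord.
  by apply: eq_bigl => i; rewrite inE andbC.
elim: K aK {Kn} => [|K IH]; first by rewrite leqn0 => /eqP ->; rewrite subrr big_geq.
rewrite leq_eqVlt => /predU1P[->|aK]; first by rewrite subrr big_geq.
rewrite big_nat_recr //=; have /andP[_ h] := lnS_diff_bounds K.
by apply: le_trans (lerD (IH aK) h); rewrite [leRHS]addrC subrKA.
Qed.

Lemma harmonic_sum_mono n (S S' : {set 'I_n}) :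
  S \subset S' -> harmonic_sum R S <= harmonic_sum R S'.
Proof.
move=> /finset.setIidPr SS; rewrite /harmonic_sum [leRHS](big_setID S) /= SS lerDl.
by apply: sumr_ge0 => i _; rewrite invr_ge0.
Qed.

Lemma one_sub_inv_expn N w : (0 < N)%N ->
  (1 - N%:R^-1) ^+ (N * w) <= expR (- w%:R) :> R.
Proof.
move=> N0; have NR : 0 < N%:R :> R by rewrite ltr0n.
have -> : - w%:R = (N * w)%:R * - N%:R^-1 :> R.
  by rewrite natrM mulrN mulrAC divff ?mul1r ?lt0r_neq0.
rewrite expRM_natl lerXn2r ?nnegrE ?expR_ge0 //.
  by rewrite subr_ge0 invf_le1 // ler1n.
exact: expR_ge1Dx.
Qed.

(** One term of the exponential series bounds [expR w] from below. *)
Lemma expRN_le w k : (0 < w)%N -> expR (- w%:R) <= k.+1`!%:R / w%:R ^+ k.+1 :> R.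
Proof.
move=> w0; have wR : 0 < w%:R :> R by rewrite ltr0n.
rewrite expRN -invf_div.
rewrite lef_pV2 ?posrE ?expR_gt0 ?divr_gt0 ?exprn_gt0 ?ltr0n ?fact_gt0 //.
by apply: le_trans (expR_ge1Dxn k (ltW wR)); rewrite lerDr.
Qed.

(** The parameters are [a = w ^ 2], [K = w ^ 7] and [T = n.+1 * w], which make [T / (n.+1 * a)] and
    [K * a / n.+1] of order [1 / w]. *)
Lemma Pr_stable_husbands_ln c C d w n (G : 'I_n.+1) :
  let L : R := ln n.+1%:R in
  0 < d -> d <= C - 1 -> d <= 2^-1 - c -> 12 / d <= L -> 1 <= L ->
  (w ^ 10 <= n.+1 < w.+1 ^ 10)%N -> (0 < w)%N ->
  1 - Pr R [set p | (c * L <= #|stable_husbands p G|%:R)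
                    && (#|stable_husbands p G|%:R <= C * L)]%SET
  <= (2 * (2 ^+ 10 * 11`!%:R) + 4) / w%:R + 16 / d ^+ 2 / L.
Proof.
move=> L d0 dC dc dL L1 /andP[wN Nw] w0.
have wR : 0 < w%:R :> R by rewrite ltr0n.
have NR : 0 < n.+1%:R :> R by rewrite ltr0n.
have dL12 : 12 <= d * L by rewrite mulrC -ler_pdivrMr.
set H := harmonic_sum R [set: 'I_n.+1]%SET.
set M := harmonic_sum R [set i : 'I_n.+1 | (w ^ 2 <= i < w ^ 7)%N]%SET.
have H_le : H <= 1 + L by apply: harmonic_sum_le.
have M_le : M <= H.
  by apply: harmonic_sum_mono; apply/fintype.subsetP => i; rewrite inE.
(* The sum is about [7 ln w - 2 ln w], and [ln w] is at least [L / 10 - 1]; 6 collects the losses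
   from factors 2. *)
have M_ge : L / 2 - 6 <= M.
  have h : ln (w ^ 7).+1%:R - ln (w ^ 2).+1%:R <= M.
    apply: harmonic_sum_ge; rewrite leq_pexp2l //=.
    by apply: leq_trans wN; rewrite leq_pexp2l.
  have ln2 : ln 2 <= 1 :> R by rewrite -[2]/(1 + 1); apply: le_ln1Dx; lra.
  have h1 : 7 * ln w%:R <= ln (w ^ 7).+1%:R :> R.
    rewrite mulr_natl -lnXn // ler_ln ?posrE ?exprn_gt0 ?ltr0n // -natrX ler_nat.
    exact: leqnSn.
  have h2 : ln (w ^ 2).+1%:R <= 1 + 2 * ln w%:R :> R.
    apply: le_trans (_ : ln (2 * w%:R ^+ 2) <= _).
      rewrite ler_ln ?posrE ?mulr_gt0 ?exprn_gt0 ?ltr0n //.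
      rewrite -natrX -natrM ler_nat mul2n -addnn -addn1 leq_add2l.
      by rewrite expn_gt0 w0.
    by rewrite lnM ?posrE ?exprn_gt0 ?ltr0n // lnXn // mulr_natl lerD2r.
  have h3 : L <= 10 * (1 + ln w%:R) :> R.
    apply: le_trans (_ : ln ((2 * w%:R) ^+ 10) <= _).
      rewrite /L ler_ln ?posrE ?exprn_gt0 ?mulr_gt0 ?ltr0n //.
      rewrite -natrM -natrX ler_nat; apply: leq_trans (ltnW Nw) _.
      by rewrite leq_exp2r // mul2n -addnn -addn1 leq_add2l.
    rewrite lnXn ?mulr_gt0 ?ltr0n // [10 * _]mulr_natl lerMn2r //= lnM ?posrE ?ltr0n //.
    by rewrite lerD2r.
  lra.
(* Half of the margin [d * L] is left to Chebyshev; the other half is at least 6 and absorbs the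
   constants in [H_le] and [M_ge]. *)
have d2 : 0 < d * L / 2 by lra.
apply: le_trans (@Pr_stable_husbands R n.+1 G (w ^ 2) (w ^ 7) (n.+1 * w)
  (c * L) (C * L) (d * L / 2) d2 _ _) _.
- have : d * L <= (C - 1) * L by rewrite ler_wpM2r //; lra.
  rewrite -/H; lra.
- have : d * L <= (2^-1 - c) * L by rewrite ler_wpM2r //; lra.
  rewrite -/M; lra.
rewrite -/H -/M; apply: lerD.
  have t1 : n.+1%:R * (1 - n.+1%:R^-1) ^+ (n.+1 * w)
      <= 2 ^+ 10 * 11`!%:R / w%:R :> R.
    (* The power 11 beats [n.+1 <= (2 * w) ^ 10] by one factor [w]. *)
    have e : (1 - n.+1%:R^-1) ^+ (n.+1 * w) <= 11`!%:R / w%:R ^+ 11 :> R.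
      exact: le_trans (one_sub_inv_expn _ _) (expRN_le _ _).
    have Nle : n.+1%:R <= (2 * w%:R) ^+ 10 :> R.
      rewrite -natrM -natrX ler_nat; apply: leq_trans (ltnW Nw) _.
      by rewrite leq_exp2r // mul2n -addnn -addn1 leq_add2l.
    apply: le_trans (ler_pM (ltW NR) _ Nle e) _.
      by rewrite exprn_ge0 // subr_ge0 invf_le1 // ler1n.
    rewrite le_eqVlt; apply/orP; left; apply/eqP.
    move: (11`!%:R : R) => F; rewrite exprMn [_ ^+ 11]exprSr invfM.
    by rewrite mulrA -[_ * F]mulrA; field; rewrite lt0r_neq0.
  have t2 : (n.+1 * w)%:R / (n.+1%:R * (w ^ 2).+1%:R) <= w%:R^-1 :> R.
    rewrite natrM invfM mulrACA divff ?lt0r_neq0 // mul1r ler_pdivrMr ?ltr0n //.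
    by rewrite ler_pdivlMl // -natrM ler_nat mulnn leqnSn.
  have t3 : (w ^ 7)%:R * (w ^ 2).+1%:R / n.+1%:R <= 2 / w%:R :> R.
    rewrite ler_pdivrMr // mulrAC ler_pdivlMr // -!natrM ler_nat.
    apply: leq_trans (_ : 2 * w ^ 10 <= _)%N; last by rewrite leq_mul2l.
    have -> : (2 * w ^ 10 = w ^ 7 * (2 * w ^ 2) * w)%N by ring.
    rewrite leq_mul // leq_mul // mul2n -addnn.
    by rewrite -[X in (X < _)%N]addn0 ltn_add2l expn_gt0 w0.
  have -> : (2 * (2 ^+ 10 * 11`!%:R) + 4) / w%:R =
    2 * (2 ^+ 10 * 11`!%:R / w%:R + w%:R^-1) + 2 / w%:R :> R.
    move: (2 ^+ 10 * 11`!%:R : R) => F; field; exact: lt0r_neq0.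
  by rewrite lerD // ler_pM2l // lerD.
have L0 : 0 < L by lra.
rewrite ler_pdivrMr ?exprn_gt0 //.
(* [H + M] is at most [2 * (1 + L)], hence at most [4 * L] as [1 <= L]. *)
have -> : 16 / d ^+ 2 / L * (d * L / 2) ^+ 2 = 4 * L by field; rewrite !lt0r_neq0.
lra.
Qed.

End Estimates.

(** * Passage to the limit *)

Local Open Scope classical_set_scope.

Theorem mainTheorem1 (R : realType) (c C : R) (hc : c < 2^-1) (hC : 1 < C)
    (G : forall n : nat, 'I_n.+1) :
  (fun n : nat =>
     Pr R [set p : profile n.+1 |
            (c * ln (n.+1%:R) <= #|stable_husbands p (G n)|%:R)
            && (#|stable_husbands p (G n)|%:R <= C * ln (n.+1%:R))]%SET)
    @ \oo --> (1 : R).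
Proof.
pose d := Num.min (C - 1) (2^-1 - c).
have d0 : 0 < d by rewrite lt_min !subr_gt0 hC hc.
pose B : R := 2 * (2 ^+ 10 * 11`!%:R) + 4.
have B0 : 0 < B.
  rewrite /B; move: (11`!%:R : R) (ler0n R 11`!) => F F0.
  by rewrite ltr_wpDl // mulr_ge0 // mulr_ge0 // exprn_ge0.
apply/cvgrPdist_le => e e0.
(* For [w] at least [W] the first error term is at most [e / 2]. *)
pose W := (Num.bound (2 * B / e)).+1.
(* The last entry makes the second error term at most [e / 2]; the others are the conditions on [L]
   in [Pr_stable_husbands_ln]. *)
pose A := Num.max (Num.max 1 (12 / d)) (2 * (16 / d ^+ 2) / e).
exists (maxn (W ^ 10) (Num.bound (expR A))) => // n /=.
rewrite geq_max => /andP[Wn An].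
have [w wn] := exists_tenth_root (ltn0Sn n).
have Ww : (W <= w)%N.
  rewrite -ltnS -(@ltn_exp2r _ _ 10) //; case/andP: wn => _.
  by apply: leq_ltn_trans; apply: leqW.
have w0 : (0 < w)%N by apply: leq_trans Ww.
have wR : 0 < w%:R :> R by rewrite ltr0n.
have AL : A <= ln n.+1%:R.
  rewrite -[A]expRK ler_ln ?posrE ?expR_gt0 ?ltr0n //.
  apply/ltW/(lt_le_trans (archi_boundP (expR_ge0 A))).
  by rewrite ler_nat; apply: leqW.
have := AL; rewrite !ge_max => /andP[/andP[L1 dL] eL].
have L0 : 0 < ln n.+1%:R :> R by apply: lt_le_trans L1.
rewrite ger0_norm ?subr_ge0 ?Pr_le1 //.
apply: le_trans (Pr_stable_husbands_ln (G n) d0 _ _ dL L1 wn w0) _.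
- by rewrite ge_min lexx.
- by rewrite ge_min lexx orbT.
rewrite -/B [leRHS](splitr e); apply: lerD.
  rewrite ler_pdivrMr // mulrAC ler_pdivlMr // -ler_pdivrMl // mulrC [B * 2]mulrC.
  have x0 : 0 <= 2 * B / e by rewrite divr_ge0 ?mulr_ge0 // ltW.
  apply/ltW/(lt_le_trans (archi_boundP x0)).
  by rewrite ler_nat; apply: leq_trans Ww; apply: leqnSn.
by rewrite ler_pdivrMr // mulrAC ler_pdivlMr // -ler_pdivrMl // mulrC [_ * 2]mulrC.
Qed.
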